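(* In the setting of the context, assume $q<q_c$, that $B$ is invertible (so $m=n$), and that $A$ is invertible. Then the stability threshold satisfies $$\bar\delta(q)\ge\lambda_{\min}\{\Xi(A^\top PA)^{-1}\Xi\},$$ where $\Xi=(Q+(1-q)c_2A^\top P_0^2A)^{1/2}$, $c_2=\dfrac{\lambda_{\min}(R)\lambda_{\min}(BB^\top)}{\lambda_{\max}(R+B^\top PB)^2}$, $P$ is the positive definite solution of the modified Riccati equation with parameter $q$ and $P_0$ that with parameter $0$.
   Context: Let $A\in\mathbb{R}^{n\times n}$, $B\in\mathbb{R}^{n\times m}$ with $(A,B)$ stabilizable, and let $Q$, $R$ be symmetric positive definite. Let $q\in(0,1)$ be the loss probability of $x_{t+1}=Ax_t+\lambda_tBu_t$ with i.i.d. $\lambda_t$, $\mathcal P(\lambda_t=0)=q$. For $p\in[0,1)$ the modified Riccati equation with parameter $p$ is $X=Q+A^\top XA-(1-p)A^\top XB(R+B^\top XB)^{-1}B^\top XA$; $q_c$ is the critical loss probability such that for every $p\in[0,q_c)$ this equation has a unique positive definite solution. For $\hat q\in[0,q_c)$ let $\hat P$ be the positive definite solution for parameter $\hat q$ and $\hat K=-(R+B^\top\hat PB)^{-1}B^\top\hat PA$. Define $\mathcal C(q,\hat q)=Q+(1-q)\hat K^\top R\hat K-(q-\hat q)A^\top\hat PB(R+B^\top\hat PB)^{-1}B^\top\hat PA$ and the stability threshold $\bar\delta(q)=\sup\{\delta\ge0:\ \mathcal C(q,\hat q)\succ0 \text{ for all } \hat q\in[0,q_c)\text{ with } q-\hat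 q<\delta\}$ (possibly $+\infty$). *)

(* Defs.v *)
From HB Require Import structures.
From mathcomp Require Import all_boot all_order all_algebra.
From mathcomp Require Import all_classical all_reals ereal.
From mathcomp Require Import complex.
Set Implicit Arguments. Unset Strict Implicit. Unset Printing Implicit Defensive.
Import Order.TTheory GRing.Theory Num.Theory.
Local Open Scope ring_scope.
Local Open Scope classical_set_scope.

Section Defs.
Variable R : realType.

Definition posdef n (M : 'M[R]_n) : Prop :=
  M^T = M /\ forall x : 'cV[R]_n, x != 0 -> 0 < (x^T *m M *m x) 0 0.
Definition possemidef n (M : 'M[R]_n) : Prop :=
  M^T = M /\ forall x : 'cV[R]_n, 0 <= (x^T *m M *m x) 0 0.

Definition lambda_min n (M : 'M[R]_n) : R := inf [set a | eigenvalue M a].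
Definition lambda_max n (M : 'M[R]_n) : R := sup [set a | eigenvalue M a].

Definition schur_stable n (M : 'M[R]_n) : Prop :=
  forall z : R[i], eigenvalue (map_mx (fun x : R => (x%:C)%C) M) z -> `|z| < 1.

Definition stabilizable n m (A : 'M[R]_n) (B : 'M[R]_(n, m)) : Prop :=
  exists K : 'M[R]_(m, n), schur_stable (A + B *m K).

Definition MRE n m (A : 'M[R]_n) (B : 'M[R]_(n, m)) (Q : 'M[R]_n) (Rm : 'M[R]_m)
    (p : R) (X : 'M[R]_n) : Prop :=
  X = Q + A^T *m X *m A
        - (1 - p) *: (A^T *m X *m B *m invmx (Rm + B^T *m X *m B) *m B^T *m X *m A).

Definition MRE_unique_pd n m A B Q Rm (p : R) : Prop :=
  exists X : 'M[R]_n, posdef X /\ @MRE n m A B Q Rm p X /\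
    forall Y, posdef Y -> MRE A B Q Rm p Y -> Y = X.

Definition q_crit n m A B Q Rm : R :=
  sup [set r : R | 0 <= r <= 1 /\
        forall p : R, 0 <= p < r -> @MRE_unique_pd n m A B Q Rm p].

Definition gainK n m (A : 'M[R]_n) (B : 'M[R]_(n, m)) (Rm : 'M[R]_m)
    (Phat : 'M[R]_n) : 'M[R]_(m, n) :=
  - (invmx (Rm + B^T *m Phat *m B) *m B^T *m Phat *m A).

(* C(q, qhat), with Phat the positive definite solution for parameter qhat *)
Definition Cmat n m (A : 'M[R]_n) (B : 'M[R]_(n, m)) (Q : 'M[R]_n) (Rm : 'M[R]_m)
    (q qhat : R) (Phat : 'M[R]_n) : 'M[R]_n :=
  let K := gainK A B Rm Phat in
  Q + (1 - q) *: (K^T *m Rm *m K)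
    - (q - qhat) *: (A^T *m Phat *m B *m invmx (Rm + B^T *m Phat *m B)
                       *m B^T *m Phat *m A).

Definition delta_bar n m A B Q Rm (q : R) : \bar R :=
  ereal_sup [set (d%:E)%E | d in [set d : R | 0 <= d /\
     forall qhat : R, 0 <= qhat < @q_crit n m A B Q Rm -> q - qhat < d ->
       forall Phat : 'M[R]_n, posdef Phat -> MRE A B Q Rm qhat Phat ->
         posdef (Cmat A B Q Rm q qhat Phat)]].

End Defs.

(* Main.v *)
(** Write [w = A x], let [X] solve the equation for [qhat < q], let [K] be its gain and
    [W = Rm + B^T X B]. The hypothesis on the eigenvalue says that
    [(q - qhat) w^T P w < x^T Q x + (1 - q) c2 |P0 w|^2], and positivity of [C (q, qhat)]
    that [(q - qhat) (K x)^T W (K x) < x^T Q x + (1 - q) (K x)^T Rm (K x)]. Solutions are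
    monotone in the loss probability, so [P0 <= X <= P]. This does not give
    [P0 ^ 2 <= X ^ 2], as squaring is not operator monotone, so the two right-hand sides
    cannot be compared directly. But [(K x)^T W (K x) <= w^T X w] is not tight, and a
    scalar inequality shows that its slack suffices as long as
    [(1 - q) lambda_min Rm < (q - qhat) lambda_max (Rm + B^T P B)]; otherwise
    [(q - qhat) W <= (1 - q) Rm] and positivity is clear. *)
Require Import Defs.
From HB Require Import structures.
From mathcomp Require Import all_boot all_order all_algebra.
From mathcomp Require Import all_classical all_reals ereal.
From mathcomp Require Import complex.
From mathcomp Require Import ring lra.
Set Implicit Arguments. Unset Strict Implicit. Unset Printing Implicit Defensive.
Import Order.TTheory GRing.Theory Num.Theory.
Local Open Scope ring_scope.

(** * Bilinear and quadratic forms of real matrices *)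

Section BilinearForms.
Variable R : realType.

Definition bform m n (M : 'M[R]_(m, n)) (x : 'cV[R]_m) (y : 'cV[R]_n) : R :=
  (x^T *m M *m y) 0 0.
Definition qform n (M : 'M[R]_n) (x : 'cV[R]_n) : R := bform M x x.

Lemma bformDl m n (M : 'M[R]_(m, n)) x y z :
  bform M (x + y) z = bform M x z + bform M y z.
Proof. by rewrite /bform linearD /= !mulmxDl mxE. Qed.

Lemma bformDr m n (M : 'M[R]_(m, n)) x y z :
  bform M x (y + z) = bform M x y + bform M x z.
Proof. by rewrite /bform mulmxDr mxE. Qed.

Lemma bformZl m n (M : 'M[R]_(m, n)) a x y : bform M (a *: x) y = a * bform M x y.
Proof. by rewrite /bform linearZ /= -!scalemxAl mxE. Qed.

Lemma bformZr m n (M : 'M[R]_(m, n)) a x y : bform M x (a *: y) = a * bform M x y.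
Proof. by rewrite /bform -scalemxAr mxE. Qed.

Lemma bformDm m n (M N : 'M[R]_(m, n)) x y :
  bform (M + N) x y = bform M x y + bform N x y.
Proof. by rewrite /bform mulmxDr mulmxDl mxE. Qed.

Lemma bformZm m n a (M : 'M[R]_(m, n)) x y : bform (a *: M) x y = a * bform M x y.
Proof. by rewrite /bform -scalemxAr -scalemxAl mxE. Qed.

Lemma bformC n (M : 'M[R]_n) x y : M^T = M -> bform M x y = bform M y x.
Proof.
move=> sM; transitivity ((x^T *m M *m y)^T 0 0); first by rewrite mxE.
by rewrite !trmx_mul trmxK sM mulmxA.
Qed.

Lemma bform_mulr m n k (M : 'M[R]_(m, n)) (N : 'M[R]_(n, k)) x y :
  bform M x (N *m y) = bform (M *m N) x y.
Proof. by rewrite /bform !mulmxA. Qed.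

Lemma bform_mull m n k (M : 'M[R]_(m, n)) (N : 'M[R]_(m, k)) x y :
  bform M (N *m x) y = bform (N^T *m M) x y.
Proof. by rewrite /bform trmx_mul !mulmxA. Qed.

Lemma qform_mul m n (M : 'M[R]_m) (N : 'M[R]_(m, n)) x :
  qform M (N *m x) = qform (N^T *m M *m N) x.
Proof. by rewrite /qform bform_mulr bform_mull mulmxA. Qed.

Lemma qformDm n (M N : 'M[R]_n) x : qform (M + N) x = qform M x + qform N x.
Proof. exact: bformDm. Qed.

Lemma qformZm n a (M : 'M[R]_n) x : qform (a *: M) x = a * qform M x.
Proof. exact: bformZm. Qed.

Lemma qformNm n (M : 'M[R]_n) x : qform (- M) x = - qform M x.
Proof. by rewrite -scaleN1r qformZm mulN1r. Qed.

Lemma qformZ n (M : 'M[R]_n) a x : qform M (a *: x) = a ^+ 2 * qform M x.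
Proof. by rewrite /qform bformZl bformZr mulrA. Qed.

Lemma qformN n (M : 'M[R]_n) x : qform M (- x) = qform M x.
Proof. by rewrite -scaleN1r qformZ sqrrN expr1n mul1r. Qed.

Lemma qformD n (M : 'M[R]_n) x y : M^T = M ->
  qform M (x + y) = qform M x + 2 * bform M x y + qform M y.
Proof.
move=> sM; rewrite /qform bformDl !bformDr (bformC y x sM); ring.
Qed.

Lemma qform0 n (M : 'M[R]_n) : qform M 0 = 0.
Proof. by rewrite /qform /bform mulmx0 mxE. Qed.

Lemma qform1E n (x : 'cV[R]_n) : qform 1%:M x = \sum_i x i 0 ^+ 2.
Proof.
rewrite /qform /bform mulmx1 mxE; apply: eq_bigr => i _.
by rewrite !mxE expr2.
Qed.

Lemma qform1_ge0 n (x : 'cV[R]_n) : 0 <= qform 1%:M x.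
Proof. by rewrite qform1E; apply: sumr_ge0 => i _; exact: sqr_ge0. Qed.

Lemma qform1_gt0 n (x : 'cV[R]_n) : x != 0 -> 0 < qform 1%:M x.
Proof.
move=> x0; rewrite lt_neqAle qform1_ge0 andbT eq_sym; apply: contra x0.
rewrite qform1E psumr_eq0 => [/allP h|i _]; last exact: sqr_ge0.
apply/eqP/matrixP => i j; rewrite ord1 mxE.
by have /eqP := h i (mem_index_enum _); move/eqP; rewrite sqrf_eq0 => /eqP.
Qed.

(** * Positive definite and semidefinite matrices *)

Lemma posdef_sym n (M : 'M[R]_n) : posdef M -> M^T = M. Proof. by case. Qed.

Lemma posdef_gt0 n (M : 'M[R]_n) x : posdef M -> x != 0 -> 0 < qform M x.
Proof. by case=> _; apply. Qed.

Lemma posdef_ge0 n (M : 'M[R]_n) x : posdef M -> 0 <= qform M x.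
Proof.
move=> pM; have [->|x0] := eqVneq x 0; first by rewrite qform0.
exact/ltW/posdef_gt0.
Qed.

Lemma posdef1 n : posdef (1%:M : 'M[R]_n).
Proof. by split=> [|x]; [rewrite trmx1|exact: qform1_gt0]. Qed.

Lemma possemidefZ n a (M : 'M[R]_n) : 0 <= a -> possemidef M -> possemidef (a *: M).
Proof.
move=> a0 [sM pM]; split=> [|x]; first by rewrite linearZ /= sM.
by rewrite -[leRHS]/(qform _ x) qformZm mulr_ge0 //; exact: pM.
Qed.

Lemma unitmx_ker0 n (M : 'M[R]_n) (x : 'cV_n) : M \in unitmx -> M *m x = 0 -> x = 0.
Proof. by move=> uM Mx; rewrite -(mulKmx uM x) Mx mulmx0. Qed.

Lemma posdef_possemidef n (M : 'M[R]_n) : posdef M -> possemidef M.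
Proof. by move=> pM; split=> [|x]; [exact: posdef_sym|exact: posdef_ge0]. Qed.

Lemma ker0_unitmx n (M : 'M[R]_n) :
  (forall x : 'cV_n, M *m x = 0 -> x = 0) -> M \in unitmx.
Proof.
(* [kermx] is a left kernel, so it is taken for [M^T]: its rows, transposed, are columns killed by
   [M]. *)
move=> h; rewrite -unitmx_tr -row_free_unit -kermx_eq0; apply/eqP/row_matrixP => i.
rewrite row0; apply: trmx_inj; rewrite trmx0; apply: h.
apply: trmx_inj; rewrite trmx_mul trmxK trmx0.
by apply/sub_kermxP; exact: row_sub.
Qed.

Lemma posdef_unit n (M : 'M[R]_n) : posdef M -> M \in unitmx.
Proof.
move=> pM; apply: ker0_unitmx => x Mx0; apply/eqP/negPn/negP => x0.
by have := posdef_gt0 pM x0; rewrite /qform /bform -mulmxA Mx0 mulmx0 mxE ltxx.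
Qed.

Lemma congr_sym m n (M : 'M[R]_m) (N : 'M[R]_(m, n)) :
  M^T = M -> (N^T *m M *m N)^T = N^T *m M *m N.
Proof. by move=> sM; rewrite !trmx_mul trmxK sM mulmxA. Qed.

Lemma posdef_congr m n (M : 'M[R]_m) (N : 'M[R]_(m, n)) :
  (forall x : 'cV_n, N *m x = 0 -> x = 0) -> posdef M -> posdef (N^T *m M *m N).
Proof.
move=> N0 pM; split=> [|x x0]; first exact/congr_sym/posdef_sym.
rewrite -[X in 0 < X]/(qform _ x) -qform_mul; apply: posdef_gt0 => //.
by apply: contra x0 => /eqP /N0 ->.
Qed.

Lemma posdefD n (M N : 'M[R]_n) : posdef M -> possemidef N -> posdef (M + N).
Proof.
move=> pM [sN pN]; split=> [|x x0]; first by rewrite linearD /= sN (posdef_sym pM).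
rewrite -[X in 0 < X]/(qform _ x) qformDm.
by apply: ltr_wpDr; [exact: pN|exact: posdef_gt0].
Qed.

Lemma possemidef_congr m n (M : 'M[R]_m) (N : 'M[R]_(m, n)) :
  possemidef M -> possemidef (N^T *m M *m N).
Proof.
move=> [sM pM]; split=> [|x]; first exact: congr_sym.
by rewrite -[X in 0 <= X]/(qform _ x) -qform_mul; exact: pM.
Qed.

Lemma cauchy_schwarz n (N : 'M[R]_n) x y : possemidef N ->
  bform N x y ^+ 2 <= qform N x * qform N y.
Proof.
move=> [sN pN].
set a := qform N x; set b := bform N x y; set c := qform N y.
have a0 : 0 <= a by exact: pN.
have c0 : 0 <= c by exact: pN.
have key s t : 0 <= s ^+ 2 * a + 2 * (s * t * b) + t ^+ 2 * c.
  have := pN (s *: x + t *: y).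
  rewrite -[X in 0 <= X]/(qform _ (s *: x + t *: y)) qformD // !qformZ.
  by rewrite bformZl bformZr [s * (t * _)]mulrA.
have [a_0|aN0] := eqVneq a 0; last first.
  have ap : 0 < a by rewrite lt_neqAle eq_sym aN0.
  (* This choice gives [0 <= a * (a * c - b ^+ 2)]. *)
  have h := key (- b) a.
  rewrite -subr_ge0 -(pmulr_rge0 _ ap); apply: le_trans h _.
  by rewrite le_eqVlt; apply/orP; left; apply/eqP; ring.
have [->|bN0] := eqVneq b 0; first by rewrite expr0n mulr_ge0.
(* With [a = 0] the form is affine in [s]; this [s] gives it the negative value [- (c + 2)]. *)
have := key (- (c + 1) / b) 1; rewrite a_0.
have -> : (- (c + 1) / b) ^+ 2 * 0 + 2 * (- (c + 1) / b * 1 * b) + 1 ^+ 2 * c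
   = - (c + 2) by field.
by rewrite oppr_ge0 leNgt ltr_wpDl.
Qed.

(** * Rayleigh bounds and extremal eigenvalues *)

Lemma qform_le_norm n (M : 'M[R]_n) :
  exists2 C, 0 < C & forall x, qform M x <= C * qform 1%:M x.
Proof.
(* Each [|x_i| |x_j|] is at most [|x|^2]; the summand 1 keeps the constant positive for [M = 0]. *)
exists (1 + \sum_i \sum_j `|M i j|) => [|x].
  by rewrite ltr_pwDl // sumr_ge0 // => i _; rewrite sumr_ge0.
have s0 := qform1_ge0 x.
have xi i : `|x i 0| ^+ 2 <= qform 1%:M x.
  rewrite real_normK ?num_real // qform1E (bigD1 i) //= lerDl.
  by apply: sumr_ge0 => j _; exact: sqr_ge0.
have xij i j : `|x i 0| * `|x j 0| <= qform 1%:M x.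
  have := xi i; have := xi j; have := sqr_ge0 (`|x i 0| - `|x j 0|); nra.
rewrite mulrDl mul1r; apply: ler_wpDl => //.
rewrite /qform {1}/bform mxE mulr_suml.
under eq_bigr do rewrite mxE mulr_suml.
rewrite exchange_big /=; apply: ler_sum => i _; rewrite mulr_suml.
apply: ler_sum => j _; rewrite mxE.
apply: le_trans (ler_norm _) _; rewrite !normrM [_ * `|M _ _|]mulrC -mulrA.
by apply: ler_wpM2l => //; exact: xij.
Qed.

Lemma eigenvalue_qform n (M : 'M[R]_n) a : eigenvalue M a ->
  exists2 x : 'cV_n, x != 0 & qform M x = a * qform 1%:M x.
Proof.
case/eigenvalueP => v vM v0; exists v^T; first by rewrite trmx_eq0.
by rewrite /qform /bform trmxK vM -scalemxAl mulmx1 mxE.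
Qed.

(* The largest [t] with [t I <= M] makes [M - t I] singular: a nonsingular
   positive semidefinite matrix is bounded below by a positive multiple of [I]. *)
Lemma rayleigh_min n (M : 'M[R]_n) : (0 < n)%N -> M^T = M ->
  exists2 l, eigenvalue M l & forall x, l * qform 1%:M x <= qform M x.
Proof.
move=> n0 sM.
pose E := [set t : R | forall x, t * qform 1%:M x <= qform M x]%classic.
pose e : 'cV[R]_n := const_mx 1.
have e0 : e != 0.
  apply/eqP => /matrixP/(_ (Ordinal n0) 0)/eqP.
  by rewrite !mxE oner_eq0.
have ub x t : x != 0 -> E t -> t <= qform M x / qform 1%:M x.
  by move=> x0 Et; rewrite ler_pdivlMr ?qform1_gt0.
have [C C0 hC] := qform_le_norm (- M).
have EC : E (- C).
  by move=> x; have := hC x; rewrite qformNm mulNr lerNl.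
have hs : has_sup E.
  by split; [exists (- C)|exists (qform M e / qform 1%:M e) => t /ub; apply].
pose l := sup E.
have El : E l.
  move=> x; have [->|x0] := eqVneq x 0; first by rewrite !qform0 mulr0.
  rewrite -ler_pdivlMr ?qform1_gt0 //; apply: ge_sup; first by exists (- C).
  by move=> t; exact: ub.
exists l => //.
rewrite /eigenvalue /eigenspace kermx_eq0 row_free_unit; apply/negP => uN.
set N := M - l%:M in uN.
have NE : N = M + (- l) *: 1%:M by rewrite scaleNr scalemx1.
have sN : N^T = N by rewrite NE linearD /= linearZ /= trmx1 sM.
have qN x : qform N x = qform M x - l * qform 1%:M x.
  by rewrite NE qformDm qformZm mulNr.
have pN : possemidef N.
  by split=> // x; rewrite -[X in 0 <= X]/(qform N x) qN subr_ge0; exact: El.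
have [D D0 hD] := qform_le_norm (invmx N).
have bound x : qform 1%:M x <= D * qform N x.
  have [->|x0] := eqVneq x 0; first by rewrite !qform0 mulr0.
  have s0 := qform1_gt0 x0.
  (* Since [(N^-1 x)^T N x = |x|^2], this reads [|x|^4 <= (x^T N^-1 x) (x^T N x)]. *)
  have := cauchy_schwarz (invmx N *m x) x pN.
  rewrite bform_mull trmx_inv sN mulVmx // qform_mul trmx_inv sN mulVmx // mul1mx.
  rewrite -[bform _ _ _]/(qform 1%:M x) expr2 => h.
  rewrite -(ler_pM2l s0); apply: le_trans h _.
  rewrite mulrA [qform _ x * D]mulrC; apply: ler_wpM2r (hD x).
  by case: pN => _; apply.
have : E (l + D^-1).
  move=> x; rewrite mulrDl -lerBrDl -qN mulrC ler_pdivrMr // mulrC; exact: bound.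
move/(sup_upper_bound hs); rewrite -/l gerDl invr_le0 => h.
by have := lt_le_trans D0 h; rewrite ltxx.
Qed.

Lemma lambda_min_attained n (M : 'M[R]_n) : (0 < n)%N -> M^T = M ->
  eigenvalue M (lambda_min M) /\
  forall x, lambda_min M * qform 1%:M x <= qform M x.
Proof.
move=> n0 sM; have [l el hl] := rayleigh_min n0 sM.
suff -> : lambda_min M = l by [].
have lb a : eigenvalue M a -> l <= a.
  move=> /eigenvalue_qform [x x0 hx].
  by rewrite -(ler_pM2r (qform1_gt0 x0)) -hx; exact: hl.
apply/eqP; rewrite eq_le; apply/andP; split.
  by apply: ge_inf => //; exists l => a; exact: lb.
by apply: lb_le_inf; [exists l|move=> a; exact: lb].
Qed.

Lemma lambda_min_le n (M : 'M[R]_n) x : M^T = M ->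
  lambda_min M * qform 1%:M x <= qform M x.
Proof.
case: n M x => [|n] M x sM; last by case: (lambda_min_attained (ltn0Sn n) sM).
by rewrite [x]flatmx0 !qform0 mulr0.
Qed.

Lemma lambda_min_gt0 n (M : 'M[R]_n) : (0 < n)%N -> posdef M -> 0 < lambda_min M.
Proof.
move=> n0 pM; have [/eigenvalue_qform [x x0 hx] _] :=
  lambda_min_attained n0 (posdef_sym pM).
by rewrite -(pmulr_lgt0 _ (qform1_gt0 x0)) -hx; exact: posdef_gt0.
Qed.

Lemma lambda_maxE n (M : 'M[R]_n) : lambda_max M = - lambda_min (- M).
Proof.
rewrite /lambda_max /lambda_min /inf opprK; congr (sup _).
have eigN (N : 'M[R]_n) a : eigenvalue N a -> eigenvalue (- N) (- a).
  case/eigenvalueP => v vN v0; apply/eigenvalueP; exists v => //.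
  by rewrite mulmxN vN scaleNr.
apply/seteqP; split=> [a /= ea|_ [a /= ea <-]].
  by exists (- a); rewrite ?opprK //; exact: eigN.
by rewrite -[M]opprK; exact: eigN.
Qed.

Lemma lambda_max_ge n (M : 'M[R]_n) x : M^T = M ->
  qform M x <= lambda_max M * qform 1%:M x.
Proof.
move=> sM; rewrite lambda_maxE mulNr lerNr -qformNm; apply: lambda_min_le.
by rewrite linearN /= sM.
Qed.

(** If [M >= l I] and [N <= C I], then [e = l / (C + l)] works. Keeping [e] below 1 makes [1 - e]
    usable as a contraction factor. *)
Lemma posdef_dominates n (M N : 'M[R]_n) : posdef M ->
  exists2 e, 0 < e < 1 & forall x, e * qform N x <= qform M x.
Proof.
case: n M N => [|n] M N pM.
  by exists 2^-1 => [|x]; rewrite ?[x]flatmx0 ?qform0 ?mulr0 //; apply/andP; split; lra.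
have l0 := lambda_min_gt0 (ltn0Sn n) pM; set l := lambda_min M in l0.
have [C C0 hC] := qform_le_norm N.
have D0 : 0 < C + l by rewrite addr_gt0.
exists (l / (C + l)) => [|x].
  by rewrite divr_gt0 //= ltr_pdivrMr // mul1r ltrDr.
apply: le_trans (lambda_min_le x (posdef_sym pM)).
rewrite -/l -mulrA ler_wpM2l ?(ltW l0) // ler_pdivrMl //.
apply: le_trans (hC x) _; rewrite ler_wpM2r ?qform1_ge0 //; lra.
Qed.

End BilinearForms.

(** * Monotonicity of Riccati solutions in the loss probability *)

Section RiccatiMonotonicity.
Variable R : realType.

(* If [D >= - c P] then [D >= - c (1 - e) P]; the least such [c >= 0] is thus 0. *)
Lemma lyapunov_ge0 n (D P A F : 'M[R]_n) (p e : R) :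
  posdef P -> 0 <= p <= 1 -> 0 < e < 1 ->
  (forall x, p * qform D (A *m x) + (1 - p) * qform D (F *m x) <= qform D x) ->
  (forall x, p * qform P (A *m x) + (1 - p) * qform P (F *m x)
             <= (1 - e) * qform P x) ->
  forall x, 0 <= qform D x.
Proof.
move=> pP /andP[p0 p1] /andP[e0 e1] hD hP x.
have [d /andP[d0 d1] hd] := posdef_dominates (- D) pP.
pose E := [set c : R | 0 <= c /\ forall z, - (c * qform P z) <= qform D z]%classic.
have Ed : E d^-1.
  split=> [|z]; first by rewrite invr_ge0 ltW.
  by rewrite lerNl -qformNm ler_pdivlMl.
have stepE c : E c -> E (c * (1 - e)).
  move=> [c0 hc]; split=> [|z]; first by rewrite mulr_ge0 // subr_ge0 ltW.
  have h1 := ler_wpM2l p0 (hc (A *m z)).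
  have q0 : 0 <= 1 - p by rewrite subr_ge0.
  have h2 := ler_wpM2l q0 (hc (F *m z)).
  have h3 := ler_wpM2l c0 (hP z).
  apply: le_trans (hD z); apply: le_trans (lerD h1 h2).
  rewrite -subr_ge0; move: h3; rewrite -subr_ge0; congr (0 <= _); ring.
have lbE : has_lbound E by exists 0 => c [].
have nE : (E !=set0)%classic by exists d^-1.
have r0 : 0 < 1 - e by rewrite subr_gt0.
have i0 : inf E <= 0.
  (* [E] is stable under multiplication by [1 - e], so [inf E / (1 - e)] is again a lower bound;
     this excludes [inf E > 0]. *)
  have h : inf E / (1 - e) <= inf E.
    apply: lb_le_inf => // c /stepE h.
    by rewrite ler_pdivrMr //; apply: ge_inf.
  move: h; rewrite ler_pdivrMr // mulrBr mulr1 lerDl oppr_ge0 pmulr_lle0 //.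
have [->|x0] := eqVneq x 0; first by rewrite qform0.
have Px := posdef_gt0 pP x0.
have : - qform D x / qform P x <= inf E.
  by apply: lb_le_inf => // c [_ /(_ x)]; rewrite ler_pdivrMr // lerNl.
by move=> /le_trans /(_ i0); rewrite ler_pdivrMr // mul0r oppr_le0.
Qed.

Variables (n m : nat) (A : 'M[R]_n) (B : 'M[R]_(n, m)) (Q : 'M[R]_n) (Rm : 'M[R]_m).

Definition input_weight (X : 'M[R]_n) : 'M[R]_m := Rm + B^T *m X *m B.

Lemma input_weight_posdef X : posdef Rm -> posdef X -> posdef (input_weight X).
Proof. by move=> pR /posdef_possemidef/(possemidef_congr B); exact: posdefD. Qed.

Lemma qform_input_weight X u :
  qform (input_weight X) u = qform Rm u + qform X (B *m u).
Proof. by rewrite qformDm -qform_mul. Qed.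

Section FixedSolution.
Variable X : 'M[R]_n.
Hypotheses (pR : posdef Rm) (pX : posdef X).
Let W := input_weight X.
Let K := gainK A B Rm X.

Lemma gainK_eq : W *m K = - (B^T *m X *m A).
Proof.
rewrite /K /gainK -/W mulmxN !mulmxA mulmxV ?mul1mx //.
exact/posdef_unit/input_weight_posdef.
Qed.

Lemma gainK_tr : K^T = - (A^T *m X *m B *m invmx W).
Proof.
rewrite /K /gainK -/W linearN /= !trmx_mul trmx_inv trmxK.
by rewrite (posdef_sym pX) (posdef_sym (input_weight_posdef pR pX)) !mulmxA.
Qed.

(** Turns the correction term of the Riccati equation, which also occurs in [Cmat], into the form of
    [W] at the input [K x]. *)
Lemma gainK_quadratic :
  A^T *m X *m B *m invmx W *m B^T *m X *m A = K^T *m W *m K.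
Proof. by rewrite -[RHS]mulmxA gainK_eq gainK_tr mulmxN mulNmx opprK !mulmxA. Qed.

Lemma MRE_qform p x : MRE A B Q Rm p X ->
  qform X x = qform Q x + qform X (A *m x) - (1 - p) * qform W (K *m x).
Proof.
move=> E; rewrite {1}E -/W gainK_quadratic.
by rewrite !qformDm qformNm qformZm -!qform_mul qform_input_weight.
Qed.

(** Completion of the square in the input [v]: the one-step cost is least at [v = K x]. *)
Lemma lqr_cost x v :
  qform X (A *m x + B *m v) + qform Rm v
    = qform X (A *m x) - qform W (K *m x) + qform W (v - K *m x).
Proof.
have sX := posdef_sym pX; have sW := posdef_sym (input_weight_posdef pR pX).
rewrite !qformD // qformN (qform_input_weight X v).
have -> : bform W v (- (K *m x)) = bform X (A *m x) (B *m v).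
  rewrite -scaleN1r bformZr bform_mulr gainK_eq -scaleN1r bformZm mulrA.
  by rewrite mulrNN !mul1r (bformC (A *m x)) // bform_mull -bform_mulr.
ring.
Qed.

Lemma Cmat_qform q qhat x : qform (Cmat A B Q Rm q qhat X) x =
  qform Q x + (1 - q) * qform Rm (K *m x) - (q - qhat) * qform W (K *m x).
Proof.
by rewrite /Cmat -/W gainK_quadratic !qformDm qformNm !qformZm -!qform_mul qform_input_weight.
Qed.

Lemma Cmat_sym q qhat : Q^T = Q ->
  (Cmat A B Q Rm q qhat X)^T = Cmat A B Q Rm q qhat X.
Proof.
move=> sQ; rewrite /Cmat -/W gainK_quadratic -/K.
have := congr_sym K (posdef_sym (input_weight_posdef pR pX)); rewrite -/W.
have := congr_sym K (posdef_sym pR).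
move: (K^T *m Rm *m K) (K^T *m W *m K) => S T sS sT.
by rewrite !linearD linearN !linearZ /= sQ sS sT.
Qed.

End FixedSolution.

(* The gain of the larger loss probability is feasible but suboptimal for [X], so
   [Y - X] dominates its own image under the closed loop operator, which
   contracts the form [Y]. *)
Lemma MRE_monotone p q (X Y : 'M[R]_n) :
  posdef Q -> posdef Rm -> 0 <= p -> p <= q -> q <= 1 ->
  posdef X -> MRE A B Q Rm p X -> posdef Y -> MRE A B Q Rm q Y ->
  forall x, qform X x <= qform Y x.
Proof.
move=> pQ pR p0 pq q1 pX eX pY eY.
have p1 : p <= 1 by exact: le_trans q1.
pose K := gainK A B Rm Y.
have [e e01 he] := posdef_dominates Y pQ.
(* By [lqr_cost] at the optimal input, the two sides differ by [(q - p) (K x)^T W (K x)], with [W]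
   the input weight of [Y]. *)
have hY x : qform Q x + p * qform Y (A *m x)
    + (1 - p) * (qform Y ((A + B *m K) *m x) + qform Rm (K *m x)) <= qform Y x.
  rewrite [leRHS](MRE_qform pR pY _ eY) mulmxDl -mulmxA lqr_cost // -/K subrr qform0.
  have := posdef_ge0 (K *m x) (input_weight_posdef pR pY).
  by move=> /(mulr_ge0 (_ : 0 <= q - p)); rewrite subr_ge0 => /(_ pq); lra.
have hX x : qform X x <= qform Q x + p * qform X (A *m x)
    + (1 - p) * (qform X ((A + B *m K) *m x) + qform Rm (K *m x)).
  rewrite [leLHS](MRE_qform pR pX _ eX) mulmxDl -mulmxA lqr_cost //.
  set z := K *m x - _.
  have := posdef_ge0 z (input_weight_posdef pR pX).
  by move=> /(mulr_ge0 (_ : 0 <= 1 - p)); rewrite subr_ge0 => /(_ p1); lra.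
move=> x; rewrite -subr_ge0 -qformNm -qformDm.
apply: (@lyapunov_ge0 _ _ Y A (A + B *m K) p e) => // [|z|z].
- by rewrite p0.
- by rewrite !qformDm !qformNm; have := hX z; have := hY z; lra.
(* The contraction comes from the term in [Q], since [e Y <= Q]. *)
- have := hY z; have := he z.
  have := posdef_ge0 (K *m z) pR.
  by move=> /(mulr_ge0 (_ : 0 <= 1 - p)); rewrite subr_ge0 => /(_ p1); lra.
Qed.

End RiccatiMonotonicity.

(** * Auxiliary matrix and scalar inequalities *)

(** For [y = N v], Cauchy-Schwarz for [N] gives [|y|^4 = (y^T N v)^2 <= (y^T N y) (v^T N v)], and
    [y^T N y <= L |y|^2]. A squared matrix is thus bounded by a form linear in it, to which
    monotonicity applies. *)
Lemma qform_square_le (R : realType) n (N : 'M[R]_n) (L : R) v : possemidef N ->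
  (forall x, qform N x <= L * qform 1%:M x) ->
  qform 1%:M (N *m v) <= L * qform N v.
Proof.
move=> pN hL; set y := N *m v.
have yE : qform 1%:M y = bform N y v by rewrite /qform {2}/y bform_mulr mul1mx.
have [y0|yN0] := eqVneq y 0.
  by rewrite /qform /bform -[_ *m N *m v]mulmxA -/y y0 !mulmx0 mxE mulr0.
rewrite -(ler_pM2l (qform1_gt0 yN0)) -expr2 [in leLHS]yE.
apply: le_trans (cauchy_schwarz _ _ pN) _.
rewrite mulrCA mulrA; apply: ler_wpM2r (hL y).
by case: pN => _; apply.
Qed.

(** Choose [y] with [Xi y = M x]. Then [l |y|^2 <= x^T M x] for the least eigenvalue [l], and [(x^T
    M x)^2 = (y^T Xi x)^2 <= |y|^2 |Xi x|^2]; eliminating [|y|^2] gives the claim. *)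
Lemma lambda_min_congr_lt (R : realType) n (Xi M : 'M[R]_n) (d : R) :
  Xi^T = Xi -> posdef (Xi *m Xi) -> posdef M -> 0 < d ->
  d < lambda_min (Xi *m invmx M *m Xi) ->
  forall x, x != 0 -> d * qform M x < qform (Xi *m Xi) x.
Proof.
move=> sXi pXi pM d0 dl x x0.
have uXi : Xi \in unitmx by have := posdef_unit pXi; rewrite unitmx_mul => /andP[].
have uM := posdef_unit pM; have sM := posdef_sym pM.
set l := lambda_min _ in dl.
have [y Xiy] : exists y, Xi *m y = M *m x.
  by exists (invmx Xi *m (M *m x)); rewrite mulKVmx.
have a0 := posdef_gt0 pM x0; set a := qform M x in a0 *.
have g0 := posdef_gt0 pXi x0; set g := qform (Xi *m Xi) x in g0 *.
have s0 := qform1_ge0 y; set s := qform 1%:M y in s0.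
have lsa : l * s <= a.
  have sT : (Xi *m invmx M *m Xi)^T = Xi *m invmx M *m Xi.
    by rewrite !trmx_mul trmx_inv sM sXi mulmxA.
  apply: le_trans (lambda_min_le y sT) _.
  by rewrite -{1}sXi -qform_mul Xiy qform_mul sM mulmxV // mul1mx.
have asg : a ^+ 2 <= s * g.
  have := cauchy_schwarz y (Xi *m x) (posdef_possemidef (posdef1 R n)).
  rewrite qform_mul sXi mulmx1 -/g -/s; congr (_ ^+ 2 <= _).
  have -> : bform 1%:M y (Xi *m x) = bform 1%:M x (Xi *m y).
    by rewrite !bform_mulr mul1mx bformC.
  by rewrite Xiy bform_mulr mul1mx.
have dsa : d * s < a.
  have [->|sN0] := eqVneq s 0; first by rewrite mulr0.
  by apply: lt_le_trans lsa; rewrite ltr_pM2r // lt_neqAle eq_sym sN0.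
rewrite -(ltr_pM2l a0) mulrCA -expr2.
apply: le_lt_trans (ler_wpM2l (ltW d0) asg) _.
by rewrite mulrA ltr_pM2r.
Qed.

(** To be read with [s = |u|^2], [a = (v - u)^T M (v - u)], [b = u^T Rm u], [m = u^T M u],
    [d = q - qhat] and [th = 1 - q]; then [a + 2 * b + m] is [w^T X w]. *)
Lemma gain_scalar_bound (R : realFieldType) (rho Lam s a b m d th Qx : R) :
  0 < rho -> rho <= Lam -> 0 <= a -> 0 <= s -> rho * s <= b -> b + m <= Lam * s ->
  0 < d -> 0 <= th -> 0 < Qx ->
  d * (a + 2 * b + m) < Qx + th * (rho / Lam ^+ 2 * ((Lam - rho) * (a + 2 * b + m))) ->
  0 < Qx + th * b - d * (b + m).
Proof.
move=> rho0 rhoL a0 s0 hb hbm d0 th0 Qx0.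
have Lam0 : 0 < Lam by exact: lt_le_trans rhoL.
have b0 : 0 <= b by apply: le_trans hb; rewrite mulr_ge0 // ltW.
have [h|h] := lerP (d * Lam) (th * rho) => hyp.
  have h1 := ler_wpM2l (ltW d0) hbm.
  have h2 := ler_wpM2l th0 hb.
  suff : d * (Lam * s) <= th * (rho * s) by lra.
  by rewrite !mulrA ler_wpM2r.
pose k := rho / Lam ^+ 2 * (Lam - rho).
have kE : k * Lam ^+ 2 = rho * (Lam - rho) by rewrite /k; field; lra.
have L0 : 0 <= Lam - rho by rewrite subr_ge0.
have L2 : 0 < Lam ^+ 2 by exact: exprn_gt0.
(* From [th * rho < d * Lam] and [Lam - rho <= Lam]; it lets [d * a] absorb the part of the
   hypothesis in [a]. *)
have kd : th * k <= d.
  rewrite -(ler_pM2r L2) -mulrA kE mulrA expr2 mulrA.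
  apply: ler_pM => //; [|exact: ltW|lra].
  by rewrite mulr_ge0 // ltW.
(* By [rm], [rho * (2 * b + m) <= (Lam + rho) * b], so the left side times [Lam ^+ 2] is at most
   [(Lam ^+ 2 - rho ^+ 2) * b]. *)
have kb : k * (2 * b + m) <= b.
  rewrite -(ler_pM2r L2) mulrAC kE.
  have rm : rho * m <= (Lam - rho) * b.
    have := ler_wpM2l (ltW rho0) hbm; have := ler_wpM2l (ltW Lam0) hb; nra.
  have := ler_wpM2l L0 rm; have : 0 <= rho ^+ 2 * b by rewrite mulr_ge0 // sqr_ge0.
  nra.
have h1 := ler_wpM2r a0 kd.
have h2 := ler_wpM2l th0 kb.
have h3 : 0 <= d * b by rewrite mulr_ge0 // ltW.
move: hyp; rewrite (_ : th * _ = th * k * a + th * (k * (2 * b + m))); first by lra.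
by rewrite /k; ring.
Qed.

(** * Positivity of [C (q, qhat)] by the sign of [q - qhat] *)

Section Threshold.
Variables (R : realType) (n : nat) (A B Q Rm : 'M[R]_n).
Hypotheses (pQ : posdef Q) (pR : posdef Rm) (uB : B \in unitmx).

Lemma Cmat_posdef_small_gap q qhat (X : 'M[R]_n) : posdef X ->
  q <= 1 -> q <= qhat -> posdef (Cmat A B Q Rm q qhat X).
Proof.
move=> pX q1 qq; split=> [|x x0]; first exact/Cmat_sym/posdef_sym.
rewrite -[ltRHS]/(qform _ x) Cmat_qform //.
have Q0 := posdef_gt0 pQ x0.
set K := gainK _ _ _ _.
have h1 : 0 <= (1 - q) * qform Rm (K *m x).
  by rewrite mulr_ge0 ?subr_ge0 ?posdef_ge0.
have h2 : 0 <= (qhat - q) * qform (input_weight B Rm X) (K *m x).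
  by rewrite mulr_ge0 ?subr_ge0 ?posdef_ge0 //; exact: input_weight_posdef.
lra.
Qed.

(* With [v = B^-1 A x], [u = K x] and [M = B^T X B], the bound [B^T P0 B <= Lam - rho]
   gives [|B^T P0 B v|^2 <= (Lam - rho) v^T M v]. Passing from [P] to [X] in the
   hypothesis leaves the gain [v^T M v - u^T (Rm + M) u], which absorbs the part of
   the [c2] term not covered by [u^T Rm u]. *)
Lemma Cmat_posdef_large_gap q qhat (P P0 X : 'M[R]_n) :
  posdef P -> posdef P0 -> posdef X -> qhat < q -> q <= 1 ->
  (forall x, qform P0 x <= qform X x) -> (forall x, qform X x <= qform P x) ->
  (forall x, x != 0 -> (q - qhat) * qform P (A *m x) <
    qform Q x + (1 - q) * (lambda_min Rm * lambda_min (B *m B^T)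
      / lambda_max (Rm + B^T *m P *m B) ^+ 2 * qform 1%:M (P0 *m (A *m x)))) ->
  posdef (Cmat A B Q Rm q qhat X).
Proof.
move=> pP pP0 pX qq q1 hP0 hP hyp.
split=> [|x x0]; first exact/Cmat_sym/posdef_sym.
have n0 : (0 < n)%N.
  by case: n x x0 => // x; rewrite [x]flatmx0 eqxx.
rewrite -[ltRHS]/(qform _ x) Cmat_qform //.
have := hyp x x0; rewrite -/(input_weight B Rm P).
set Lam := lambda_max _; set rho := lambda_min Rm; set beta := lambda_min _.
have sX := posdef_sym pX; have sP0 := posdef_sym pP0.
have pWX := input_weight_posdef B pR pX.
have Kx := gainK_eq A B pR pX.
set K := gainK _ _ _ _ in Kx *.
have rho0 : 0 < rho by exact: lambda_min_gt0.
have rho_le y : rho * qform 1%:M y <= qform Rm y by exact/lambda_min_le/posdef_sym.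
have Lam_ge y : qform Rm y + qform P (B *m y) <= Lam * qform 1%:M y.
  rewrite -qform_input_weight; exact/lambda_max_ge/posdef_sym/input_weight_posdef.
have rhoLam : rho <= Lam.
  rewrite -(ler_pM2r (qform1_gt0 x0)); apply: le_trans (rho_le x) _.
  by apply: le_trans (Lam_ge x); rewrite lerDl posdef_ge0.
have [v vE] : exists v, B *m v = A *m x.
  by exists (invmx B *m (A *m x)); rewrite mulKVmx.
pose M := B^T *m X *m B; have sM : M^T = M by exact: congr_sym.
have ME y : qform M y = qform X (B *m y) by rewrite -qform_mul.
have [u uE] : exists u, u = - (K *m x) by exists (- (K *m x)).
have -> : K *m x = - u by rewrite uE opprK.
have Wu : input_weight B Rm X *m u = M *m v.
  by rewrite uE mulmxN mulmxA Kx mulNmx opprK /M -!mulmxA vE.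
have uv : bform M v u = qform (input_weight B Rm X) u.
  by rewrite bformC // -[M]mul1mx -bform_mulr -Wu bform_mulr mul1mx.
(* Expand the square of [v - u]; the cross term is [v^T M u = u^T (Rm + M) u] because
   [(Rm + M) u = M v]. *)
have tE : qform X (A *m x) = qform M (v - u) + 2 * qform Rm u + qform M u.
  have := qformD v (- u) sM; rewrite qformN -[- u]scaleN1r bformZr uv.
  rewrite qform_input_weight -ME (ME v) vE scaleN1r => ->; ring.
(* [Rm + B^T P B <= Lam] and [Rm >= rho] give [B^T P0 B <= B^T P B <= Lam - rho]; the remaining form
   is linear in [P0], so [P0 <= X] applies. *)
have M0_le : qform 1%:M (B^T *m P0 *m B *m v) <= (Lam - rho) * qform X (A *m x).
  apply: le_trans (@qform_square_le _ _ _ (Lam - rho) v _ _) _.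
  - exact/possemidef_congr/posdef_possemidef.
  - move=> y; rewrite -qform_mul.
    have := hP0 (B *m y); have := hP (B *m y); have := Lam_ge y; have := rho_le y.
    by rewrite mulrBl; lra.
  - by rewrite -qform_mul vE ler_wpM2l // subr_ge0.
have beta_le : beta * qform 1%:M (P0 *m (A *m x)) <= qform 1%:M (B^T *m P0 *m B *m v).
  apply: le_trans (lambda_min_le _ _) _; first by rewrite trmx_mul trmxK.
  by rewrite -!mulmxA vE [leRHS]qform_mul trmxK mulmx1.
rewrite !qformN => hx.
rewrite qform_input_weight -ME.
have Lam0 : 0 < Lam by exact: lt_le_trans rhoLam.
apply: (@gain_scalar_bound _ rho Lam (qform 1%:M u) (qform M (v - u))) => //.
- by rewrite ME posdef_ge0.
- exact: qform1_ge0.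
- by apply: le_trans (Lam_ge u); rewrite lerD2l ME.
- by rewrite subr_gt0.
- by rewrite subr_ge0.
- exact: posdef_gt0.
rewrite -tE; apply: le_lt_trans (lt_le_trans hx _).
  by rewrite ler_wpM2l ?hP // subr_ge0 ltW.
rewrite lerD2l ler_wpM2l ?subr_ge0 // [rho * beta / _]mulrAC -[leLHS]mulrA.
rewrite ler_wpM2l ?(le_trans beta_le M0_le) //.
by rewrite divr_ge0 ?sqr_ge0 // ltW.
Qed.

End Threshold.

Theorem theorem5 (R : realType) (n : nat)
    (A B Q Rm P P0 Xi : 'M[R]_n) (q : R) :
  stabilizable A B ->
  posdef Q -> posdef Rm ->
  0 < q < 1 ->
  q < q_crit A B Q Rm ->
  B \in unitmx -> A \in unitmx ->
  posdef P -> MRE A B Q Rm q P ->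
  posdef P0 -> MRE A B Q Rm 0 P0 ->
  let c2 := lambda_min Rm * lambda_min (B *m B^T)
            / (lambda_max (Rm + B^T *m P *m B)) ^+ 2 in
  possemidef Xi ->
  Xi *m Xi = Q + ((1 - q) * c2) *: (A^T *m P0 *m P0 *m A) ->
  ((lambda_min (Xi *m invmx (A^T *m P *m A) *m Xi))%:E <= delta_bar A B Q Rm q)%E.
Proof.
move=> _ pQ pR /andP[q0 q1] _ uB uA pP eP pP0 eP0 c2 [sXi _] XiE.
set l := lambda_min _.
(* Admissible thresholds are nonnegative; the maximum with 0 makes the sign of [l] irrelevant, and a
   positive gap below it is below [l]. *)
apply: (@le_trans _ _ (Num.max 0 l)%:E); first by rewrite lee_fin le_max lexx orbT.
apply: ereal_sup_ubound; exists (Num.max 0 l) => //=.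
split=> [|qhat /andP[qh0 _] gap X pX eX]; first by rewrite le_max lexx.
have [qq|qq] := lerP q qhat; first exact: Cmat_posdef_small_gap (ltW q1) qq.
have gap0 : 0 < q - qhat by rewrite subr_gt0.
have {}gap : q - qhat < l by move: gap; rewrite lt_max ltNge (ltW gap0).
apply: (@Cmat_posdef_large_gap _ _ _ _ _ _ pQ pR uB _ _ P P0) => //.
- exact: ltW.
- apply: (MRE_monotone pQ pR _ _ _ pP0 eP0 pX eX) => //.
  by apply: le_trans (ltW q1); exact: ltW.
- by apply: (MRE_monotone pQ pR _ _ _ pX eX pP eP) => //; exact: ltW.
rewrite -/c2 => x x0.
have XiQ z : qform (Xi *m Xi) z =
    qform Q z + (1 - q) * (c2 * qform 1%:M (P0 *m (A *m z))).
  rewrite XiE qformDm qformZm mulmxA qform_mul mulmx1 trmx_mul (posdef_sym pP0).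
  by rewrite !mulmxA -mulrA.
have n0 : (0 < n)%N.
  by clear -x0; case: n x x0 => // x; rewrite [x]flatmx0 eqxx.
have pB : posdef (B *m B^T).
  have -> : B *m B^T = B^T^T *m 1%:M *m B^T by rewrite trmxK mulmx1.
  apply: posdef_congr (posdef1 R n) => z.
  by apply: unitmx_ker0; rewrite unitmx_tr.
have c2_ge0 : 0 <= c2.
  by rewrite /c2 divr_ge0 ?sqr_ge0 // mulr_ge0 // ltW // lambda_min_gt0.
rewrite -XiQ qform_mul.
apply: (lambda_min_congr_lt sXi _ _ gap0 gap x0); last first.
  by apply: posdef_congr pP => z; exact: unitmx_ker0.
rewrite XiE; apply: posdefD => //; apply: possemidefZ.
  by rewrite mulr_ge0 // subr_ge0 ltW.
have -> : A^T *m P0 *m P0 *m A = (P0 *m A)^T *m 1%:M *m (P0 *m A).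
  by rewrite mulmx1 trmx_mul (posdef_sym pP0) !mulmxA.
exact/possemidef_congr/posdef_possemidef/posdef1.
Qed.
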